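(* It holds that $$\max_{x\in\mathcal{X}}\min_{y\in\mathcal{Y}(x)}L^{U}(x,y)=\max_{x\in\mathcal{X}}\min_{y\in\mathcal{Y}}L^{U}(x,y).$$ In addition, for any $y\in\mathcal{Y}$, define $t_i(x):=U_i^L+U_i^F+\sum_{j\in J}(v^L_{ij}+v^F_{ij}+w_{ij})\bigl[(1-y_j)x_j+y_j\bigr]$, $J_0:=\{j\in J:y_j=0\}$ and $J_1:=\{j\in J:y_j=1\}$. Then, for $x\in\mathcal{X}$ (with $t_i(x)>0$ for all $i\in I$) and $\theta\in\mathbb{R}$, the inequality $\theta\le L^{U}(x,y)$ holds if and only if there exist reals $\{\theta_i\}_{i\in I}$ such that $\theta\le\sum_{i\in I}h_i\theta_i$ and $$\left\|\begin{bmatrix}\bigl(2\sqrt{w_{ij}}(1-x_j)\bigr)_{j\in J_1}\\ \bigl(2\sqrt{v^F_{ij}}\,x_j\bigr)_{j\in J_0}\\ \bigl(2\sqrt{v^F_{ij}}\bigr)_{j\in J_1}\\ 2\sqrt{U_i^F}\\ t_i(x)+\theta_i-1\end{bmatrix}\right\|_2\le t_i(x)-\theta_i+1,\qquad\forall i\in I.$$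
   Context: Setting: opening new facilities changes the utilities of pre-existing facilities. $I$ is a finite nonempty set of customer nodes; $J$ (candidate sites), $J^L$ and $J^F$ (pre-existing facilities of leader and follower) are finite pairwise disjoint sets. Demand weights $h_i\ge 0$ satisfy $\sum_{i\in I}h_i=1$. With real $\alpha_j$, distances $d_{ij}\ge0$ and $\beta>0$, set $w_{ij}:=\exp\{\alpha_j-\beta d_{ij}\}>0$ for $i\in I$, $j\in J\cup J^L\cup J^F$, and $U_i^L:=\sum_{j\in J^L}w_{ij}\ge 0$, $U_i^F:=\sum_{j\in J^F}w_{ij}\ge 0$. Sensitivity parameters $v^L_{ij},v^F_{ij}\ge0$ ($i\in I$, $j\in J$) are given. The budgets $p,r$ are nonnegative integers with $p+r\le|J|$; $\mathcal{X}:=\{x\in\{0,1\}^{|J|}:\sum_jx_j\le p\}$, $\mathcal{Y}:=\{y\in\{0,1\}^{|J|}:\sum_jy_j\le r\}$, $\mathcal{Y}(x):=\{y\in\mathcal{Y}:y_j\le1-x_j\ \forall j\in J\}$. Notation: $a\vee b:=\max\{a,b\}$. The leader's market share is $$L^{U}(x,y)=\sum_{i\in I}h_i\left(\frac{U_i^L+\sum_{j\in J}v^L_{ij}(x_j\vee y_j)+\sum_{j\in J}w_{ij}x_j}{U_i^L+U_i^F+\sum_{j\in J}(v^L_{ij}+v^F_{ij}+w_{ij})(x_j\vee y_j)}\right).$$ Convention: $0/0:=0$. *)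

(* Defs.v *)
From HB Require Import structures.
From mathcomp Require Import all_boot all_order all_algebra.
From mathcomp Require Import reals constructive_ereal sequences exp.

Set Implicit Arguments.
Unset Strict Implicit.
Unset Printing Implicit Defensive.

Import Order.TTheory GRing.Theory Num.Theory.

Local Open Scope ring_scope.

(* The candidate sites J and the pre-existing facilities JL (leader) and JF
   (follower) are separate types, so their disjointness is built in; J + JL + JF
   is the set of all facilities. *)
Record market (R : realType) (I J JL JF : finType) := Market {
  demand : I -> R;
  attract : J + JL + JF -> R;
  dist : I -> J + JL + JF -> R;
  decay : R;
  sensL : I -> J -> R;
  sensF : I -> J -> R
}.

Section Model.
Context (R : realType) (I J JL JF : finType).
Implicit Types (M : market R I J JL JF) (x y : {ffun J -> bool}).

Definition weight M (i : I) (k : J + JL + JF) : R :=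
  expR (attract M k - decay M * dist M i k).

Definition site_weight M (i : I) (j : J) : R := weight M i (inl (inl j)).

Definition utilL M (i : I) : R := \sum_(j : JL) weight M i (inl (inr j)).

Definition utilF M (i : I) : R := \sum_(j : JF) weight M i (inr j).

(* The stipulation 0 / 0 = 0 is the library's: division by 0 returns 0. *)
Definition leader_share M x y : R :=
  \sum_(i : I) demand M i *
    ((utilL M i
      + \sum_(j : J) sensL M i j * Num.max (x j)%:R (y j)%:R
      + \sum_(j : J) site_weight M i j * (x j)%:R)
     / (utilL M i + utilF M i
        + \sum_(j : J) (sensL M i j + sensF M i j + site_weight M i j)
                       * Num.max (x j)%:R (y j)%:R)).

Definition leader_set (p : nat) : {set {ffun J -> bool}} :=
  [set x : {ffun J -> bool} | (\sum_(j : J) x j <= p)%N].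

Definition follower_set (r : nat) : {set {ffun J -> bool}} :=
  [set y : {ffun J -> bool} | (\sum_(j : J) y j <= r)%N].

Definition follower_set_at (r : nat) x : {set {ffun J -> bool}} :=
  [set y in follower_set r | [forall j, (y j <= 1 - x j)%N]].

Definition total_util M y (i : I) x : R :=
  utilL M i + utilF M i
  + \sum_(j : J) (sensL M i j + sensF M i j + site_weight M i j)
                 * ((1 - (y j)%:R) * (x j)%:R + (y j)%:R).

Definition sites0 y : {set J} := [set j | y j == false].

Definition sites1 y : {set J} := [set j | y j == true].

(* The norm that the library puts on matrices is the sup norm. *)
Definition norm2 (n : nat) (u : 'cV[R]_n) : R :=
  Num.sqrt (\sum_(k < n) u k 0 ^+ 2).

Definition subcol (A : {set J}) (f : J -> R) : 'cV[R]_#|A| :=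
  \col_(k < #|A|) f (enum_val k).

Definition cone_vector M y (i : I) x (theta : R) :
    'cV[R]_(#|sites1 y| + (#|sites0 y| + (#|sites1 y| + (1 + 1)))) :=
  col_mx (subcol (sites1 y)
            (fun j => 2 * Num.sqrt (site_weight M i j) * (1 - (x j)%:R)))
  (col_mx (subcol (sites0 y) (fun j => 2 * Num.sqrt (sensF M i j) * (x j)%:R))
  (col_mx (subcol (sites1 y) (fun j => 2 * Num.sqrt (sensF M i j)))
  (col_mx (const_mx (2 * Num.sqrt (utilF M i)))
          (const_mx (total_util M y i x + theta - 1))))).

End Model.

(* Main.v *)
Require Import Defs.
From HB Require Import structures.
From mathcomp Require Import all_boot all_order all_algebra.
From mathcomp Require Import reals constructive_ereal sequences exp.
From mathcomp Require Import ring lra.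

Set Implicit Arguments.
Unset Strict Implicit.
Unset Printing Implicit Defensive.

Import Order.TTheory GRing.Theory Num.Theory.

Local Open Scope ring_scope.

(* The share depends on y only through the componentwise maximum of x and y, so
   dropping from y the sites already in x leaves the share unchanged and lands
   in Y(x); hence the two inner minima agree for every x.

   For the second part, with N_i(x) the numerator of the share at i, the
   components of the cone vector other than the last have squares summing to
   4 (t_i - N_i): x_j is 0 or 1, so squaring (1 - x_j) or x_j changes nothing.
   As (t + a - 1)^2 - (t - a + 1)^2 = 4 t (a - 1), the cone constraint says
   t - N <= t (1 - a), that is a <= N / t. *)

Lemma sqrt_cone_le (R : realType) (s t a : R) : 0 < t -> 0 <= s ->
  (Num.sqrt (4 * s + (t + a - 1) ^+ 2) <= t - a + 1) = (s <= t * (1 - a)).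
Proof.
(* Squaring is legitimate only when [t - a + 1] is nonnegative. When [a > t + 1] both sides are
   false: a square root is not negative, and [t * (1 - a) < 0 <= s]. *)
move=> t0 s0; have [a_le|a_gt] := lerP a (t + 1); last first.
  have /negPf-> : ~~ (Num.sqrt (4 * s + (t + a - 1) ^+ 2) <= t - a + 1).
    rewrite -ltNge; apply: lt_le_trans (sqrtr_ge0 _); lra.
  by apply/esym/negbTE; rewrite -ltNge; nra.
have d0 : 0 <= t - a + 1 by lra.
rewrite -(ger0_norm d0) -sqrtr_sqr ler_sqrt ?sqr_ge0 //.
by apply/idP/idP => ?; nra.
Qed.

Section Model.
Context (R : realType) (I J JL JF : finType) (M : market R I J JL JF).
Implicit Types (x y : {ffun J -> bool}) (i : I).

Definition leader_util i x y : R :=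
  utilL M i + \sum_(j : J) sensL M i j * Num.max (x j)%:R (y j)%:R
  + \sum_(j : J) site_weight M i j * (x j)%:R.

(** What is left of the denominator of the share once its numerator is removed. It is split over
    [sites1] and [sites0] so that each term matches one block of the cone vector. *)
Definition follower_util i x y : R :=
  \sum_(j in sites1 y) site_weight M i j * (1 - (x j)%:R)
  + \sum_(j in sites0 y) sensF M i j * (x j)%:R
  + \sum_(j in sites1 y) sensF M i j + utilF M i.

Lemma max_bool (a b : bool) :
  Num.max a%:R b%:R = (1 - b%:R) * a%:R + b%:R :> R.
Proof.
rewrite maxEle ler_nat; case: a; case: b => /=; ring.
Qed.

Lemma leader_shareE x y : leader_share M x y =
  \sum_(i : I) demand M i * (leader_util i x y / total_util M y i x).
Proof.
apply: eq_bigr => i _; congr (_ * (_ / (_ + _))).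
by apply: eq_bigr => j _; rewrite max_bool.
Qed.

Lemma total_utilE i x y :
  total_util M y i x = leader_util i x y + follower_util i x y.
Proof.
rewrite /total_util /leader_util /follower_util.
rewrite [\sum_(j in sites0 y) _]big_mkcond.
rewrite ![\sum_(j in sites1 y) _]big_mkcond /=.
(* With every sum now ranging over all of [J], the identity reduces to one per site, checked on the
   four values of [x j] and [y j]. *)
rewrite (_ : \sum_j _ = \sum_j sensL M i j * Num.max (x j)%:R (y j)%:R
  + \sum_j site_weight M i j * (x j)%:R
  + (\sum_j (if j \in sites1 y then site_weight M i j * (1 - (x j)%:R) else 0)
  + \sum_j (if j \in sites0 y then sensF M i j * (x j)%:R else 0)
  + \sum_j (if j \in sites1 y then sensF M i j else 0))); first ring.
rewrite -!big_split; apply: eq_bigr => j _ /=.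
by rewrite max_bool !inE; case: (x j); case: (y j) => /=; ring.
Qed.

Lemma weight_ge0 i k : 0 <= weight M i k.
Proof. exact: expR_ge0. Qed.

Lemma utilF_ge0 i : 0 <= utilF M i.
Proof. by apply: sumr_ge0 => j _; exact: weight_ge0. Qed.

Hypothesis sensF_ge0 : forall i j, 0 <= sensF M i j.

Lemma follower_util_ge0 i x y : 0 <= follower_util i x y.
Proof.
have onemx j : 0 <= 1 - (x j)%:R :> R by rewrite subr_ge0 lern1 leq_b1.
by rewrite !addr_ge0 ?utilF_ge0 ?sumr_ge0 // => j _;
  rewrite mulr_ge0 ?weight_ge0.
Qed.

Lemma sum_sqr_subcol (A : {set J}) (f : J -> R) :
  \sum_(k < #|A|) subcol A f k 0 ^+ 2 = \sum_(j in A) f j ^+ 2.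
Proof. by rewrite [RHS]big_enum_val; apply: eq_bigr => k _; rewrite mxE. Qed.

Lemma sum_sqr_col_mx m n (u : 'cV[R]_m) (v : 'cV[R]_n) :
  \sum_(k < m + n) col_mx u v k 0 ^+ 2
  = \sum_(k < m) u k 0 ^+ 2 + \sum_(k < n) v k 0 ^+ 2.
Proof.
by rewrite big_split_ord /=; congr (_ + _); apply: eq_bigr => k _;
  rewrite ?col_mxEu ?col_mxEd.
Qed.

Lemma sqr_bool (b : bool) : b%:R ^+ 2 = b%:R :> R.
Proof. by case: b; rewrite ?expr1n ?expr0n. Qed.

Lemma norm2_cone_vector i x y a : norm2 (cone_vector M y i x a) =
  Num.sqrt (4 * follower_util i x y + (total_util M y i x + a - 1) ^+ 2).
Proof.
rewrite /norm2 /cone_vector !sum_sqr_col_mx !sum_sqr_subcol !big_ord1 !mxE.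
(* The factor 2 in each entry gives the 4 expected by [sqrt_cone_le]; nonnegativity of [c] makes the
   square undo the root. *)
have sqr2sqrt (c : R) : 0 <= c -> (2 * Num.sqrt c) ^+ 2 = 4 * c.
  by move=> c0; rewrite exprMn sqr_sqrtr //; ring.
congr Num.sqrt; rewrite (sqr2sqrt (utilF M i)) ?utilF_ge0 //.
rewrite !addrA; congr (_ + _); rewrite /follower_util !mulrDr !mulr_sumr.
congr (_ + _ + _ + _); apply: eq_bigr => j _.
- rewrite exprMn sqr2sqrt ?weight_ge0 // -mulrA; congr (_ * (_ * _)).
  by case: (x j) => /=; ring.
- by rewrite exprMn sqr2sqrt // sqr_bool mulrA.
- exact: sqr2sqrt.
Qed.

(** Both sides amount to [follower_util i x y <= t * (1 - a)] with [t] the total utility; [t > 0]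
    also allows the division to be cleared. *)
Lemma cone_constraintE i x y a : 0 < total_util M y i x ->
  (norm2 (cone_vector M y i x a) <= total_util M y i x - a + 1)
  = (a <= leader_util i x y / total_util M y i x).
Proof.
move=> t0; rewrite norm2_cone_vector sqrt_cone_le ?follower_util_ge0 //.
rewrite ler_pdivlMr // (_ : leader_util i x y
  = total_util M y i x - follower_util i x y); last by rewrite total_utilE; ring.
by apply/idP/idP => ?; lra.
Qed.

End Model.

(** For booleans, [x || (y && ~~ x)] equals [x || y], and the remaining sum of the numerator does
    not involve [y]. *)
Lemma leader_share_avoid (R : realType) (I J JL JF : finType)
    (M : market R I J JL JF) (x y : {ffun J -> bool}) :
  leader_share M x [ffun j => y j && ~~ x j] = leader_share M x y.
Proof.
have maxE j : Num.max (x j)%:R ([ffun k => y k && ~~ x k] j)%:R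
    = Num.max (x j)%:R (y j)%:R :> R.
  by rewrite ffunE !max_bool; case: (x j); case: (y j) => /=; ring.
apply: eq_bigr => i _; congr (_ * ((_ + _ + _) / (_ + _)));
  by apply: eq_bigr => j _; rewrite maxE.
Qed.

Lemma avoid_in_follower_set_at (J : finType) (r : nat) (x y : {ffun J -> bool}) :
  y \in follower_set J r ->
  [ffun j => y j && ~~ x j] \in follower_set_at r x.
Proof.
rewrite !inE => y_le; apply/andP; split.
  apply: leq_trans y_le; apply: leq_sum => j _.
  by rewrite ffunE; case: (y j); case: (x j).
by apply/forallP => j; rewrite ffunE; case: (y j); case: (x j).
Qed.

Theorem proposition9 (R : realType) (I J JL JF : finType)
    (M : market R I J JL JF) (p r : nat)
    (I_gt0 : (0 < #|I|)%N)
    (demand_ge0 : forall i, 0 <= demand M i)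
    (demand_sum1 : \sum_(i : I) demand M i = 1)
    (dist_ge0 : forall i k, 0 <= dist M i k)
    (decay_gt0 : 0 < decay M)
    (sensL_ge0 : forall i j, 0 <= sensL M i j)
    (sensF_ge0 : forall i j, 0 <= sensF M i j)
    (budget_le : (p + r <= #|J|)%N) :
  (\big[maxe/-oo%E]_(x in leader_set J p)
      \big[mine/+oo%E]_(y in follower_set_at r x) (leader_share M x y)%:E
   = \big[maxe/-oo%E]_(x in leader_set J p)
      \big[mine/+oo%E]_(y in follower_set J r) (leader_share M x y)%:E)
  /\
  (forall y, y \in follower_set J r ->
   forall x, x \in leader_set J p ->
   (forall i, 0 < total_util M y i x) ->
   forall theta : R,
     theta <= leader_share M x y <->
     exists theta_ : I -> R,
       theta <= \sum_(i : I) demand M i * theta_ i /\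
       forall i, norm2 (cone_vector M y i x (theta_ i))
                 <= total_util M y i x - theta_ i + 1).
Proof.
split.
  apply: eq_bigr => x _; apply/le_anti/andP; split.
    (* The bound must also hold against the default [+oo]. Each [y] is then matched by its
       restriction to the sites outside [x], which has the same share. *)
    apply/bigmin_geP; split; first exact: leey.
    move=> y yr; rewrite -leader_share_avoid.
    exact/bigmin_le_cond/avoid_in_follower_set_at.
  (* Conversely, a minimum over the larger set [follower_set] can only be smaller. *)
  apply: sub_bigmin => y; first by rewrite inE => /andP[].
move=> y _ x _ t0 theta; rewrite leader_shareE; split.
  (* The witness is the largest [theta_ i] that the cone constraint permits. *)
  move=> theta_le; exists (fun i => leader_util M i x y / total_util M y i x).
  by split=> // i; rewrite cone_constraintE.
move=> [theta_ [theta_le cone]]; apply: (le_trans theta_le).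
(* The bounds for single customers add up because the demand weights are nonnegative. *)
by apply: ler_sum => i _; rewrite ler_wpM2l // -cone_constraintE.
Qed.
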